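(* Let $R$ be a simple ring with center $Z(R)$, and let $L$ be a Lie ideal of $R$. Then at least one of the following holds: $L\subseteq Z(R)$; or $L=Z(R)a+Z(R)$ for some $a\in L\setminus Z(R)$; or $[R,R]\subseteq L$.
   Context: Rings are associative, not necessarily with unity. A ring $R$ is simple if $R^2\neq 0$ and its only two-sided ideals are $\{0\}$ and $R$. $Z(R)$ is the center of $R$, and $[a,b]:=ab-ba$. For subsets $A,B\subseteq R$, $[A,B]$ denotes the additive subgroup generated by all $[a,b]$ with $a\in A$, $b\in B$. A Lie ideal of $R$ is an additive subgroup $L$ with $[L,R]\subseteq L$. $Z(R)a+Z(R)=\{za+w: z,w\in Z(R)\}$. *)

(* Defs.v *)
From HB Require Import structures.
From mathcomp Require Import all_boot all_algebra.
From mathcomp Require Import mathcomp_extra boolp classical_sets.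

Set Implicit Arguments.
Unset Strict Implicit.
Unset Printing Implicit Defensive.

Import GRing.Theory.
Local Open Scope classical_set_scope.
Local Open Scope ring_scope.

(* Associative rings without any unity assumption: the rings of ssralg all
   carry a unit element 1, so they are too restrictive here. *)
HB.mixin Record Zmodule_isRng R of GRing.Zmodule R := {
  rng_mul : R -> R -> R;
  rng_mulA : associative rng_mul;
  rng_mulDl : left_distributive rng_mul +%R;
  rng_mulDr : right_distributive rng_mul +%R
}.

#[short(type="rngType")]
HB.structure Definition Rng := { R of GRing.Zmodule R & Zmodule_isRng R }.

Declare Scope rng_scope.
Delimit Scope rng_scope with rng.
Notation "x ** y" := (rng_mul x y) (at level 40, left associativity) : rng_scope.
Local Open Scope rng_scope.

Definition lie (R : rngType) (a b : R) : R := a ** b - b ** a.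

Definition center (R : rngType) : set R :=
  [set z | forall x : R, z ** x = x ** z].
Arguments center R : clear implicits.

Definition additive_subgroup (V : zmodType) (A : set V) : Prop :=
  A 0 /\ (forall x y : V, A x -> A y -> A (x - y)).

Definition lie_subgroup (R : rngType) (A B : set R) : set R :=
  smallest (@additive_subgroup R) [set lie a b | a in A & b in B].

Definition mul_subgroup (R : rngType) (A B : set R) : set R :=
  smallest (@additive_subgroup R) [set a ** b | a in A & b in B].

Definition two_sided_ideal (R : rngType) (I : set R) : Prop :=
  additive_subgroup I /\
  (forall r x : R, I x -> I (r ** x) /\ I (x ** r)).

Definition simple_rng (R : rngType) : Prop :=
  mul_subgroup [set: R] [set: R] <> [set 0] /\
  (forall I : set R, two_sided_ideal I -> I = [set 0] \/ I = [set: R]).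

Definition lie_ideal (R : rngType) (L : set R) : Prop :=
  additive_subgroup L /\ lie_subgroup L [set: R] `<=` L.

(* Main.v *)
(** Write [a, b] for the Lie bracket and Z for the center.  If [a, b] is nonzero
    for some a, b in L, then [R, R] is contained in L: the set T of all x with
    [x, R] in L contains L and all products of two elements of L, and
    [a, b] x = [a, b x] - b [a, x] shows that T contains the ideal generated by
    [a, b].

    Otherwise L is commutative, and expanding [b, [a, x y]] = 0 gives
    [a, x] y [b, z] + [b, x] y [a, z] = 0 for a, b in L.  If L is not central,
    taking b = a forces characteristic 2.  Then squares of elements of L are
    central, and they cannot all vanish, so R is unital and Z is a field.  As
    for Martindale's extended centroid, the identity now yields
    [c, x] = l [a, x] with l in Z independent of x, that is, c lies in Z a + Z.
    Taking for a a noncentral commutator [a', x] with a' in L makes Z a and Z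
    contained in L. *)

Require Import Defs.
From mathcomp Require Import all_boot all_algebra.
From mathcomp Require Import mathcomp_extra boolp classical_sets.

Import GRing.Theory.

Local Open Scope classical_set_scope.
Local Open Scope ring_scope.
Local Open Scope rng_scope.

(** * Products and Lie brackets in a ring without assumed unity *)

Lemma rng_mulr0 {R : rngType} (x : R) : x ** 0 = 0.
Proof. by apply: (addrI (x ** 0)); rewrite -rng_mulDr !addr0. Qed.

Lemma rng_mul0r {R : rngType} (x : R) : 0 ** x = 0.
Proof. by apply: (addrI (0 ** x)); rewrite -rng_mulDl !addr0. Qed.

Lemma rng_mulrN {R : rngType} (x y : R) : x ** (- y) = - (x ** y).
Proof. by apply: (addrI (x ** y)); rewrite -rng_mulDr !subrr rng_mulr0. Qed.

Lemma rng_mulNr {R : rngType} (x y : R) : (- x) ** y = - (x ** y).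
Proof. by apply: (addrI (x ** y)); rewrite -rng_mulDl !subrr rng_mul0r. Qed.

Lemma rng_mulBr {R : rngType} (x y z : R) : x ** (y - z) = x ** y - x ** z.
Proof. by rewrite rng_mulDr rng_mulrN. Qed.

Lemma rng_mulBl {R : rngType} (x y z : R) : (x - y) ** z = x ** z - y ** z.
Proof. by rewrite rng_mulDl rng_mulNr. Qed.

Lemma lieC {R : rngType} (a b : R) : lie a b = - lie b a.
Proof. by rewrite /lie opprB. Qed.

Lemma lieBl {R : rngType} (a b x : R) : lie (a - b) x = lie a x - lie b x.
Proof. by rewrite /lie rng_mulBl rng_mulBr opprD addrACA -opprD. Qed.

Lemma lieDr {R : rngType} (a x y : R) : lie a (x + y) = lie a x + lie a y.
Proof. by rewrite /lie rng_mulDl rng_mulDr opprD addrACA. Qed.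

Lemma lieBr {R : rngType} (a x y : R) : lie a (x - y) = lie a x - lie a y.
Proof. by rewrite /lie rng_mulBl rng_mulBr opprD addrACA -opprD. Qed.

Lemma lieMr {R : rngType} (a x y : R) :
  lie a (x ** y) = lie a x ** y + x ** lie a y.
Proof. by rewrite /lie rng_mulBl rng_mulBr !rng_mulA addrA subrK. Qed.

Lemma lieMl {R : rngType} (a b x : R) :
  lie (a ** b) x = a ** lie b x + lie a x ** b.
Proof. by rewrite lieC lieMr opprD addrC -rng_mulrN -rng_mulNr -!lieC. Qed.

Lemma lie_jacobi {R : rngType} (r a b : R) :
  lie r (lie a b) = lie (lie r a) b + lie a (lie r b).
Proof.
rewrite [lie a b]/lie lieBr !lieMr [lie (lie r a) b]/lie [lie a (lie r b)]/lie.
by rewrite opprD [- _ - _]addrC addrACA.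
Qed.

Lemma centerP {R : rngType} (a : R) : center R a <-> forall x, lie a x = 0.
Proof.
split=> [az x|az x]; first by rewrite /lie az subrr.
exact/subr0_eq/az.
Qed.

Lemma center_lie {R : rngType} {z : R} (zZ : center R z) x : lie z x = 0.
Proof. by move: x; apply/centerP. Qed.

Lemma noncentral_lie {R : rngType} {a : R} (aZ : ~ center R a) :
  exists x, lie a x <> 0.
Proof.
apply: contrapT => /forallNP h; apply/aZ/centerP => x.
by apply: contrapT; exact: h.
Qed.

Lemma centerM {R : rngType} {z w : R} :
  center R z -> center R w -> center R (z ** w).
Proof. by move=> zZ wZ x; rewrite -rng_mulA wZ rng_mulA zZ rng_mulA. Qed.

Lemma lie_centerl {R : rngType} {z : R} (zZ : center R z) a x :
  lie (z ** a) x = z ** lie a x.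
Proof. by rewrite lieMl (center_lie zZ) rng_mul0r addr0. Qed.

Lemma lie_centerr {R : rngType} {z : R} (zZ : center R z) a x :
  lie a (z ** x) = z ** lie a x.
Proof.
by rewrite lieMr [lie a z]lieC (center_lie zZ) oppr0 rng_mul0r add0r.
Qed.

Lemma additive_subgroupN {V : zmodType} {A : set V} {x : V} :
  additive_subgroup A -> A x -> A (- x).
Proof. by move=> [A0 AB] Ax; rewrite -sub0r; exact: AB. Qed.

Lemma additive_subgroupD {V : zmodType} {A : set V} {x y : V} :
  additive_subgroup A -> A x -> A y -> A (x + y).
Proof.
move=> sA Ax Ay; rewrite -[y]opprK; apply: sA.2 => //.
exact: additive_subgroupN.
Qed.

(** * Primeness, unity and center of a simple ring *)

Lemma simple_ideal {R : rngType} {I : set R} {x : R} :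
  simple_rng R -> two_sided_ideal I -> I x -> x <> 0 -> forall y, I y.
Proof. by move=> [_ simpR] /simpR[->//|-> //]. Qed.

Lemma simple_mul_neq0 {R : rngType} :
  simple_rng R -> ~ forall x y : R, x ** y = 0.
Proof.
move=> [RR _] mul0; apply: RR; apply/seteqP; split=> [x|x ->].
  apply: smallest_sub => [|_ [a _ [b _ <-]]]; last exact: mul0.
  by split=> // y z -> ->; rewrite subr0.
by move=> A [[A0 _] _].
Qed.

(** The [a] with [a R = 0] form a two-sided ideal; were it all of [R], every product would
    vanish. *)
Lemma simple_annl {R : rngType} {a : R} :
  simple_rng R -> (forall x, a ** x = 0) -> a = 0.
Proof.
move=> simpR a0; apply: contrapT => aN0; apply: (simple_mul_neq0 simpR).
apply: (@simple_ideal _ [set a | forall x, a ** x = 0] a) => //.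
split; first split=> [x|x y xA yA z]; first exact: rng_mul0r.
  by rewrite rng_mulBl xA yA subr0.
by move=> r x xA; split=> y; rewrite -rng_mulA xA ?rng_mulr0.
Qed.

(** For fixed [a], the [s] with [a R s = 0] form a two-sided ideal, so a nonzero [b] in it makes
    [a R R] vanish. *)
Lemma simple_prime {R : rngType} {a b : R} :
  simple_rng R -> (forall x, a ** x ** b = 0) -> a = 0 \/ b = 0.
Proof.
move=> simpR ab0; have [|bN0] := pselect (b = 0); [by right|left].
apply: (simple_annl simpR) => x; apply: (simple_annl simpR) => y; move: y x.
apply: (@simple_ideal _ [set s | forall x, a ** x ** s = 0] b) => //.
split; first split=> [x|x y xA yA z]; first exact: rng_mulr0.
  by rewrite rng_mulBr xA yA subr0.
move=> r x xA; split=> y; first by rewrite rng_mulA -(rng_mulA a) xA.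
by rewrite rng_mulA xA rng_mul0r.
Qed.

Lemma simple_central_mul_surj {R : rngType} {z : R} :
    simple_rng R -> center R z -> z <> 0 ->
  forall y, exists x, z ** x = y.
Proof.
move=> simpR zZ zN0.
have [x zxN0] : exists x, z ** x <> 0.
  apply: contrapT => /forallNP h; apply: zN0.
  by apply: (simple_annl simpR) => x; apply: contrapT; exact: h.
apply: (@simple_ideal _ [set y | exists x, z ** x = y] (z ** x)) => //.
  split; first split; first by exists 0; rewrite rng_mulr0.
    by move=> _ _ [s <-] [t <-]; exists (s - t); rewrite rng_mulBr.
  move=> r _ [s <-]; split; first by exists (r ** s); rewrite !rng_mulA zZ.
  by exists (s ** r); rewrite rng_mulA.
by exists x.
Qed.

(** By primeness a nonzero central [z] can be cancelled, so a solution [e] of [z e = z] is a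
    two-sided identity. *)
Lemma simple_unit {R : rngType} {z : R} :
    simple_rng R -> center R z -> z <> 0 ->
  exists2 e : R, center R e & forall x, e ** x = x.
Proof.
move=> simpR zZ zN0.
have zreg w : z ** w = 0 -> w = 0.
  move=> zw0; have [x|//|//] := @simple_prime _ z w simpR.
  by rewrite zZ -rng_mulA zw0 rng_mulr0.
have [e ze] := simple_central_mul_surj simpR zZ zN0 z.
have ex x : e ** x = x.
  by apply/subr0_eq/zreg; rewrite rng_mulBr rng_mulA ze subrr.
exists e => // x; rewrite ex; apply/esym/subr0_eq/zreg.
by rewrite rng_mulBr rng_mulA zZ -rng_mulA ze -zZ subrr.
Qed.

Lemma simple_center_inv {R : rngType} {e w : R} :
    simple_rng R -> center R e -> (forall x, e ** x = x) ->
    center R w -> w <> 0 ->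
  exists2 v : R, center R v & v ** w = e.
Proof.
move=> simpR eZ e1 wZ wN0.
have [v wv] := simple_central_mul_surj simpR wZ wN0 e.
exists v; last by rewrite -wZ.
move=> x; have xe : x ** e = x by rewrite -eZ e1.
rewrite -[in LHS]xe -wv !rng_mulA -(rng_mulA v x w) -wZ rng_mulA -wZ wv.
by rewrite e1.
Qed.

(** The [s] for which some [t] satisfies [u y t = v y s] for all [y] form an ideal containing [u],
    hence [e]; the [t] paired with [e] is the required ratio [l]. *)
Lemma simple_martindale {R : rngType} {e u v : R} :
    simple_rng R -> center R e -> (forall x, e ** x = x) -> u <> 0 ->
    (forall y, u ** y ** v = v ** y ** u) ->
  exists2 l : R, center R l & v = l ** u.
Proof.
move=> simpR eZ e1 uN0 uv.
have [l ul] : exists l, forall y, u ** y ** l = v ** y ** e.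
  apply: (@simple_ideal _
    [set s | exists t, forall y, u ** y ** t = v ** y ** s] u) => //; last first.
    by exists v.
  split; first split; first by exists 0 => y; rewrite !rng_mulr0.
    move=> s1 s2 [t1 h1] [t2 h2]; exists (t1 - t2) => y.
    by rewrite !rng_mulBr h1 h2.
  move=> r s [t h]; split.
    by exists (r ** t) => y; rewrite !rng_mulA -!(rng_mulA _ y) h.
  by exists (t ** r) => y; rewrite !rng_mulA h.
have {}ul y : u ** y ** l = v ** y by rewrite ul -eZ e1.
have uv1 : u ** l = v by rewrite -[u]e1 eZ ul -eZ e1.
have lZ : center R l.
  move=> y; apply/esym/subr0_eq.
  (* Both [u w y l] and [u w l y] equal [v w y]. *)
  have [w|//|//] := @simple_prime _ u (y ** l - l ** y) simpR.
  by rewrite rng_mulBr !rng_mulA ul -[u ** w ** y]rng_mulA ul rng_mulA subrr.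
by exists l => //; rewrite lZ.
Qed.

(** * Lie ideals with two noncommuting elements *)

Lemma lie_ideal_lie {R : rngType} {L : set R} {a x : R} :
  lie_ideal L -> L a -> L (lie a x).
Proof.
by move=> [_ sL] La; apply: sL => A [_]; apply; exists a => //; exists x.
Qed.

Lemma lie_ideal_noncommutative {R : rngType} {L : set R} {a b : R} :
    simple_rng R -> lie_ideal L -> L a -> L b -> lie a b <> 0 ->
  forall x y, L (lie x y).
Proof.
move=> simpR lieL La Lb abN0.
pose T := [set x | forall y, L (lie x y)].
have TL c : L c -> T c by move=> Lc y; exact: lie_ideal_lie.
have TS : additive_subgroup T.
  split=> [x|x y Tx Ty z]; last by rewrite lieBl; apply: lieL.1.2.
  by rewrite /lie rng_mul0r rng_mulr0 subrr; exact: lieL.1.1.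
have TM c d : L c -> L d -> T (c ** d).
  move=> Lc Ld x.
  have -> : lie (c ** d) x = lie c (d ** x) + lie d (x ** c).
    by rewrite /lie !rng_mulA addrA subrK.
  by apply: (additive_subgroupD lieL.1); exact: lie_ideal_lie.
have TMr c d x : L c -> L d -> T (lie c d ** x).
  move=> Lc Ld; have -> : lie c d ** x = lie c (d ** x) - d ** lie c x.
    by rewrite lieMr addrK.
  apply: TS.2; first exact/TL/lie_ideal_lie.
  by apply: TM => //; exact: lie_ideal_lie.
have TMl c d x : L c -> L d -> T (x ** lie c d).
  move=> Lc Ld; have -> : x ** lie c d = lie c (x ** d) - lie c x ** d.
    by rewrite lieMr addrC addKr.
  apply: TS.2; first exact/TL/lie_ideal_lie.
  by apply: TM => //; exact: lie_ideal_lie.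
have LN c x : L c -> L (lie x c).
  by move=> Lc; rewrite lieC; apply/(additive_subgroupN lieL.1)/lie_ideal_lie.
have TMlr x y : T (x ** lie a b ** y).
  have -> : x ** lie a b = lie x (lie a b) + lie a b ** x.
    by rewrite [lie x _]/lie subrK.
  (* By Jacobi, [[x, [a, b]]] is a sum of two brackets of elements of [L], to which [TMr]
     applies. *)
  rewrite lie_jacobi rng_mulDl [X in X + _]rng_mulDl -[_ ** x ** y]rng_mulA.
  apply: (additive_subgroupD TS); last exact: TMr.
  by apply: (additive_subgroupD TS); apply: TMr => //; exact: LN.
(* The largest two-sided ideal inside [T]; without a unity the four kinds of multiples are listed
   separately. *)
pose I := [set x | [/\ T x, forall r, T (r ** x), forall s, T (x ** s) &
  forall r s, T (r ** x ** s)]].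
have I_ideal : two_sided_ideal I.
  split; first split.
  - by split=> *; rewrite ?rng_mulr0 ?rng_mul0r; exact: TS.1.
  - move=> x y [x1 x2 x3 x4] [y1 y2 y3 y4].
    by split=> *; rewrite ?rng_mulBr ?rng_mulBl; exact: TS.2.
  move=> r x [x1 x2 x3 x4]; split; split=> *; rewrite ?rng_mulA //.
    by rewrite -rng_mulA.
  by rewrite -rng_mulA.
move=> x; suff [] : I x by [].
apply: (simple_ideal simpR I_ideal _ abN0); split=> *.
- exact/TL/lie_ideal_lie.
- exact: TMl.
- exact: TMr.
- exact: TMlr.
Qed.

(** * Commutative Lie ideals *)

Definition commutative_lie_ideal {R : rngType} (L : set R) : Prop :=
  lie_ideal L /\ (forall a b : R, L a -> L b -> lie a b = 0).

Lemma commutative_lie_mul {R : rngType} {L : set R} {a b : R} :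
    commutative_lie_ideal L -> L a -> L b ->
  forall x y, lie a x ** lie b y + lie b x ** lie a y = 0.
Proof.
move=> [lieL abL] La Lb x y.
have h z : lie b (lie a z) = 0 by apply: abL => //; exact: lie_ideal_lie.
have := h (x ** y); rewrite lieMr lieDr !lieMr !h rng_mul0r add0r.
by rewrite rng_mulr0 addr0.
Qed.

(** With [y z] for [y] in [commutative_lie_mul], the terms that bracket [y] cancel by the same
    identity. *)
Lemma commutative_lie_mul3 {R : rngType} {L : set R} {a b : R} :
    commutative_lie_ideal L -> L a -> L b ->
  forall x y z, lie a x ** y ** lie b z + lie b x ** y ** lie a z = 0.
Proof.
move=> cL La Lb x y z; have := commutative_lie_mul cL La Lb x (y ** z).
rewrite !lieMr !rng_mulDr addrACA !rng_mulA -rng_mulDl.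
by rewrite (commutative_lie_mul cL)// rng_mul0r add0r.
Qed.

(** Each [[a, x] y [a, x]] is killed by 2, by primeness they do not all vanish, and the elements
    killed by 2 form an ideal. *)
Lemma commutative_lie_ideal_char2 {R : rngType} {L : set R} {a : R} :
    simple_rng R -> commutative_lie_ideal L -> L a -> ~ center R a ->
  forall x : R, x + x = 0.
Proof.
move=> simpR cL La /noncentral_lie[x axN0].
have [[u uN0 uu]|/forall2NP h] := pselect (exists2 u : R, u <> 0 & u + u = 0).
  apply: (@simple_ideal _ [set x | x + x = 0] u) => //.
  split; first split; first by rewrite /= addr0.
    by move=> s t /= ss tt; rewrite addrACA -opprD ss tt subr0.
  by move=> r s /= ss; rewrite -rng_mulDr -rng_mulDl ss rng_mulr0 rng_mul0r.
exfalso; have [y||] := @simple_prime _ (lie a x) (lie a x) simpR; [|by []..].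
have [/contrapT//|[]] := h (lie a x ** y ** lie a x).
exact: (commutative_lie_mul3 cL La La).
Qed.

Lemma char2_opp {V : zmodType} :
  (forall x : V, x + x = 0) -> forall x : V, - x = x.
Proof. by move=> h2 x; apply: (addrI x); rewrite subrr h2. Qed.

Lemma commutative_lie_ideal_sqr {R : rngType} {L : set R} {a : R} :
    (forall x : R, x + x = 0) -> commutative_lie_ideal L -> L a ->
  center R (a ** a).
Proof.
move=> h2 [lieL abL] La; apply/centerP => x; rewrite lieMl.
have /subr0_eq -> : lie a (lie a x) = 0.
  by apply: abL => //; exact: lie_ideal_lie.
exact: h2.
Qed.

Lemma lie_ideal_sqr_neq0 {R : rngType} {L : set R} {a : R} :
    simple_rng R -> (forall x : R, x + x = 0) -> lie_ideal L -> L a -> a <> 0 ->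
  exists2 c, L c & c ** c <> 0.
Proof.
move=> simpR h2 lieL La aN0; apply: contrapT => /forall2NP h; apply: aN0.
have sq0 c : L c -> c ** c = 0 by move=> Lc; have [|/contrapT] := h c.
have aa := sq0 a La.
(* The additive group aRa, with product (axa)(aya) := axaya, is a ring; it is
   commutative with zero squares, so each of its elements satisfies uRu = 0. *)
have cube x : a ** x ** a ** x ** a = 0.
  (* Multiplying [[a, x] [a, x] = 0] on the left by [a] leaves only [a x a x a], since [a a = 0]. *)
  have := sq0 _ (lie_ideal_lie lieL La : L (lie a x)).
  move=> /(congr1 (rng_mul a)); rewrite rng_mulr0 => <-.
  rewrite rng_mulA [a ** lie a x]rng_mulBr !rng_mulA aa rng_mul0r sub0r.
  rewrite rng_mulNr rng_mulBr opprB !rng_mulA -(rng_mulA (a ** x) a a) aa.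
  by rewrite rng_mulr0 rng_mul0r subr0.
have swap x y : a ** x ** a ** y ** a = a ** y ** a ** x ** a.
  (* Linearize [cube] at [x + y]; characteristic 2 absorbs the sign. *)
  apply/subr0_eq; rewrite char2_opp// -[RHS](cube (x + y)).
  by rewrite !rng_mulDr !rng_mulDl !cube addr0 add0r addrC.
have sandwich x : a ** x ** a = 0.
  have [r||] := @simple_prime _ (a ** x ** a) (a ** x ** a) simpR; [|by []..].
  rewrite !rng_mulA swap.
  have -> : a ** r ** a ** x ** a ** x ** a = a ** r ** (a ** x ** a ** x ** a).
    by rewrite !rng_mulA.
  by rewrite cube rng_mulr0.
by have [] := simple_prime simpR sandwich.
Qed.

Lemma commutative_lie_ideal_span {R : rngType} {e : R} {L : set R} {a c : R} :
    simple_rng R -> (forall x : R, x + x = 0) -> center R e ->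
    (forall x, e ** x = x) -> commutative_lie_ideal L -> L a ->
    ~ center R a -> L c ->
  exists2 l, center R l & center R (c - l ** a).
Proof.
move=> simpR h2 eZ e1 cL La /noncentral_lie[x axN0] Lc.
have swap y z : lie a x ** y ** lie c z = lie c x ** y ** lie a z.
  by apply/subr0_eq; rewrite char2_opp//; exact: (commutative_lie_mul3 cL).
(* The case [z = x] of [swap] gives [l] from [[a, x]] and [[c, x]]; primeness then carries the
   relation to every [z]. *)
have [l lZ cl] := simple_martindale simpR eZ e1 axN0 (swap^~ x).
exists l => //; apply/centerP => z; rewrite lieBl lie_centerl//.
have [y|//|//] := @simple_prime _ (lie a x) (lie c z - l ** lie a z) simpR.
by rewrite rng_mulBr swap cl !rng_mulA -lZ !rng_mulA subrr.
Qed.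

(** If all [[a, x]] were central, a nonzero one would be invertible, and [[a, x] a = [a, x a]] would
    make [a] central. *)
Lemma noncentral_commutator {R : rngType} {e a : R} :
    simple_rng R -> center R e -> (forall x, e ** x = x) -> ~ center R a ->
  exists x, ~ center R (lie a x).
Proof.
move=> simpR eZ e1 aZ; have [x axN0] := noncentral_lie aZ.
apply: contrapT => /forallNP h; have axZ y := contrapT (h y).
have [v vZ ve] := simple_center_inv simpR eZ e1 (axZ x) axN0.
apply: aZ; rewrite -[a]e1 -ve -rng_mulA; apply: centerM => //.
have -> : lie a x ** a = lie a (x ** a).
  by rewrite lieMr [lie a a]/lie subrr rng_mulr0 addr0.
exact: axZ.
Qed.

Lemma commutator_notin_line {R : rngType} {e b : R} :
    simple_rng R -> center R e -> (forall x, e ** x = x) ->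
    center R (b ** b) -> ~ center R b ->
  exists y, forall r, center R r -> lie b y <> r ** b.
Proof.
move=> simpR eZ e1 bbZ bZ; apply: contrapT => /forallNP h.
have line y : exists2 r, center R r & lie b y = r ** b.
  by have /existsNP[r /not_implyP[rZ /contrapT yr]] := h y; exists r.
(* [[b, y b] = [b, y] b] is both [s b] and a central multiple of [b b], so [s] invertible would make
   [b] central. *)
have lieb0 y : lie b y ** b = 0.
  have [r rZ yr] := line y; have [s sZ ys] := line (y ** b).
  have sb : lie b y ** b = s ** b.
    by rewrite -ys lieMr [lie b b]/lie subrr rng_mulr0 addr0.
  rewrite sb; have [->|sN0] := pselect (s = 0); first by rewrite rng_mul0r.
  exfalso; have [v vZ ve] := simple_center_inv simpR eZ e1 sZ sN0.
  apply: bZ; rewrite -[b]e1 -ve -rng_mulA; apply: centerM => //.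
  by rewrite -sb yr -rng_mulA; exact: centerM.
have [y byN0] := noncentral_lie bZ.
(* Putting [y z] for [y] in [lieb0] yields [[b, y] z b = 0]. *)
have [z|//|b0] := @simple_prime _ (lie b y) b simpR.
  have := lieb0 (y ** z).
  by rewrite lieMr rng_mulDl -(rng_mulA y) lieb0 rng_mulr0 addr0.
by apply: byN0; rewrite b0 /lie rng_mulr0 rng_mul0r subrr.
Qed.

Lemma commutative_lie_ideal_eq {R : rngType} {L : set R} :
    simple_rng R -> commutative_lie_ideal L -> ~ L `<=` center R ->
  exists2 a : R, (L `\` center R) a &
     L = [set z ** a + w | z in center R & w in center R].
Proof.
move=> simpR cL /existsNP[a /not_implyP[La aZ]]; have lieL := cL.1.
have h2 := commutative_lie_ideal_char2 simpR cL La aZ.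
have aN0 : a <> 0.
  by move=> a0; apply: aZ; rewrite a0 => x; rewrite rng_mul0r rng_mulr0.
have [c Lc ccN0] := lie_ideal_sqr_neq0 simpR h2 lieL La aN0.
have ccZ := commutative_lie_ideal_sqr h2 cL Lc.
have [e eZ e1] := simple_unit simpR ccZ ccN0.
(* The generator is [b = [a, x]] instead of [a], because [z b = [a, z x]] lies in [L] for central
   [z]. *)
have [x bZ] := noncentral_commutator simpR eZ e1 aZ.
have := @lie_ideal_lie _ _ _ x lieL La.
have ZbL z : center R z -> L (z ** lie a x).
  by move=> zZ; rewrite -lie_centerr//; exact: lie_ideal_lie.
move: (lie a x) bZ ZbL => b bZ ZbL Lb.
have span d := commutative_lie_ideal_span simpR h2 eZ e1 cL Lb bZ (c := d).
have ZL : center R `<=` L.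
  have bbZ := commutative_lie_ideal_sqr h2 cL Lb.
  have [y yb] := commutator_notin_line simpR eZ e1 bbZ bZ.
  have [r rZ sZ] := span _ (@lie_ideal_lie _ _ _ y lieL Lb).
  have sN0 : lie b y - r ** b <> 0 by move=> /subr0_eq; exact: yb.
  have [v vZ ve] := simple_center_inv simpR eZ e1 sZ sN0.
  (* With [v] inverse to [[b, y] - r b], this writes [z] as [[b, z v y] - z v r b], a difference of
     elements of [L]. *)
  move=> z zZ; rewrite -[z]e1 eZ -ve rng_mulA rng_mulBr -lie_centerr; last first.
    exact: centerM.
  rewrite rng_mulA; apply: lieL.1.2; first exact: lie_ideal_lie.
  by apply: ZbL; do 2 apply: centerM => //.
exists b => //; apply/seteqP; split=> [d Ld|_ [z zZ [w wZ <-]]].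
  have [l lZ dl] := span d Ld; exists l => //; exists (d - l ** b) => //.
  by rewrite addrC subrK.
by apply: (additive_subgroupD lieL.1); [exact: ZbL|exact: ZL].
Qed.

Theorem theoremA (R : rngType) (simpleR : simple_rng R)
    (L : set R) (lieL : lie_ideal L) :
  L `<=` center R \/
  (exists2 a : R, (L `\` center R) a &
     L = [set z ** a + w | z in center R & w in center R]) \/
  lie_subgroup [set: R] [set: R] `<=` L.
Proof.
have [|LZ] := pselect (L `<=` center R); [by left|right].
have [cL|ncL] := pselect (forall a b : R, L a -> L b -> lie a b = 0).
  by left; exact: commutative_lie_ideal_eq.
right; have [a [b [La [Lb abN0]]]] : exists a b, L a /\ L b /\ lie a b <> 0.
  apply: contrapT => h; apply: ncL => a b La Lb; apply: contrapT => abN0.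
  by apply: h; exists a, b.
apply: smallest_sub; first exact: lieL.1.
by move=> _ [x _ [y _ <-]]; exact: (lie_ideal_noncommutative simpleR lieL La Lb).
Qed.
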